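(* Let $\Omega\subseteq\mathbb{R}^2\times\mathbb{R}^2$ be a measurable set with $\mathcal{L}^4(\Omega)>0$. Then \[ \sup_{f\in L^2(\mathbb{R}^2)\setminus\{0\}}\frac{\|W_{\mathrm{BJ}}f\|_{L^\infty(\Omega)}}{\|f\|_{L^2(\mathbb{R}^2)}^2}=\infty. \]
   Context: Functions in $L^2(\mathbb{R}^d)$ are complex-valued (here $d=2$), and $\mathcal{L}^{4}$ is Lebesgue measure on $\mathbb{R}^{4}$. For $f\in L^2(\mathbb{R}^d)$, $\tau\in(0,1)$ and $z=(x,\xi)\in\mathbb{R}^d\times\mathbb{R}^d$, the $\tau$-Wigner distribution is \[ W_\tau f(z)=\int_{\mathbb{R}^d}e^{-2\pi i\xi\cdot y}f(x+\tau y)\,\overline{f(x-(1-\tau)y)}\,dy, \] and the Born--Jordan distribution is $W_{\mathrm{BJ}}f(z)=\int_0^1 W_\tau f(z)\,d\tau$ (the integral in $\tau$ converges absolutely for a.e. $z$ and $W_{\mathrm{BJ}}f\in L^2(\mathbb{R}^{2d})$). The norm $\|W_{\mathrm{BJ}}f\|_{L^\infty(\Omega)}$ is the essential supremum on $\Omega$, equal to $\infty$ if $W_{\mathrm{BJ}}f\notin L^\infty(\Omega)$. *)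

(* Defs.v *)
From HB Require Import structures.
From mathcomp Require Import all_boot all_order all_algebra.
From mathcomp Require Import all_classical all_reals all_analysis.
From mathcomp Require Import complex.

Set Implicit Arguments.
Unset Strict Implicit.
Unset Printing Implicit Defensive.

Import Order.TTheory GRing.Theory Num.Theory.
Import numFieldNormedType.Exports.
Import ComplexField.Normc.

Local Open Scope classical_set_scope.
Local Open Scope ring_scope.

Lemma product_sigma_finite d1 d2 (T1 : measurableType d1)
    (T2 : measurableType d2) (R : realType)
    (m1 : {sigma_finite_measure set T1 -> \bar R})
    (m2 : {sigma_finite_measure set T2 -> \bar R}) :
  sigma_finite setT (m1 \x m2)%E.
Proof.
have /sigma_finiteP[F [TF ndF Foo]] := sigma_finiteT m1.
have /sigma_finiteP[G [TG ndG Goo]] := sigma_finiteT m2.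
exists (fun n => F n `*` G n).
  rewrite -setXTT TF TG predeqE => -[x y]; split.
    move=> [/= [n _ Fnx] [k _ Gky]]; exists (maxn n k) => //; split.
    - by move: x Fnx; exact/subsetPset/ndF/leq_maxl.
    - by move: y Gky; exact/subsetPset/ndG/leq_maxr.
  by move=> [n _ []/= ? ?]; split; exists n.
move=> k; have [? ?] := Foo k; have [? ?] := Goo k.
split; first exact: measurableX.
by rewrite product_measure1E// lte_mul_pinfty// ge0_fin_numE.
Qed.

(* Lebesgue measure on the Borel sets of R^2 and of R^4. They are named so as to
   carry a sigma-finite measure structure, which the library does not infer for
   a product of two sigma-finite measures. *)
Definition leb2 {R : realType} :
    set (measurableTypeR R * measurableTypeR R)%type -> \bar R :=
  (@lebesgue_measure R \x @lebesgue_measure R)%E.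

HB.instance Definition _ (R : realType) := Measure.on (@leb2 R).
HB.instance Definition _ (R : realType) :=
  Measure_isSigmaFinite.Build _ _ _ (@leb2 R)
    (product_sigma_finite (@lebesgue_measure R) (@lebesgue_measure R)).

Definition leb4 {R : realType} :
    set ((measurableTypeR R * measurableTypeR R) *
         (measurableTypeR R * measurableTypeR R))%type -> \bar R :=
  (@leb2 R \x @leb2 R)%E.

HB.instance Definition _ (R : realType) := Measure.on (@leb4 R).
HB.instance Definition _ (R : realType) :=
  Measure_isSigmaFinite.Build _ _ _ (@leb4 R)
    (product_sigma_finite (@leb2 R) (@leb2 R)).

(* The completion of the Borel measure [leb4]: Lebesgue measurable sets are the
   Caratheodory measurable sets of the outer measure induced by [leb4], and
   their Lebesgue measure is the value of this outer measure. *)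
Definition lebesgue_measurable4 (R : realType)
    (Omega : set ((R * R) * (R * R))) : Prop :=
  ((@leb4 R)^*)%mu.-cara.-measurable Omega.

Definition lebesgue4 (R : realType) (Omega : set ((R * R) * (R * R))) : \bar R :=
  ((@leb4 R)^*)%mu Omega.

Definition cintegral d (T : measurableType d) (R : realType)
    (mu : {measure set T -> \bar R}) (D : set T) (g : T -> R[i]) : R[i] :=
  Complex (\int[mu]_(t in D) complex.Re (g t))
          (\int[mu]_(t in D) complex.Im (g t)).

(* exp (i t) *)
Definition cis (R : realType) (t : R) : R[i] := Complex (cos t) (sin t).

Definition L2norm (R : realType) (f : R * R -> R[i]) : \bar R :=
  'N[@leb2 R]_2[(fun x => (normc (f x))%:E)].

(* Borel representatives of the classes in L^2(R^2); every class has one, and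
   the Wigner distributions below do not depend on the representative. *)
Definition L2 (R : realType) : set (R * R -> R[i]) :=
  [set f | [/\ measurable_fun setT (fun x => complex.Re (f x)),
               measurable_fun setT (fun x => complex.Im (f x))
             & (L2norm f < +oo)%E]].

Definition ae_zero (R : realType) (f : R * R -> R[i]) : Prop :=
  {ae @leb2 R, forall x, f x = 0}.

Definition dot2 (R : realType) (u v : R * R) : R := u.1 * v.1 + u.2 * v.2.

Definition scale2 (R : realType) (t : R) (y : R * R) : R * R :=
  (t * y.1, t * y.2).

Definition wigner_tau (R : realType) (tau : R) (f : R * R -> R[i])
    (z : (R * R) * (R * R)) : R[i] :=
  let x := z.1 in let xi := z.2 in
  cintegral (@leb2 R) setT (fun y =>
    cis (- (2 * pi * dot2 xi y)) *
    f (x + scale2 tau y) * conjc (f (x - scale2 (1 - tau) y))).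

Definition born_jordan (R : realType) (f : R * R -> R[i])
    (z : (R * R) * (R * R)) : R[i] :=
  cintegral (@lebesgue_measure R) `]0, 1[ (fun tau => wigner_tau tau f z).

(* Extending |g| by zero outside [Omega] does not change the essential supremum
   of |g| over [Omega] when [Omega] is not a null set. *)
Definition Linfty_norm (R : realType) (Omega : set ((R * R) * (R * R)))
    (g : (R * R) * (R * R) -> R[i]) : \bar R :=
  'N[@leb4 R]_+oo[(fun z => (normc (g z))%:E) \_ Omega].

(* Main.v *)
Require Import Defs.
From mathcomp Require Import all_boot all_order all_algebra.
From mathcomp Require Import all_classical all_reals all_analysis.
From mathcomp Require Import complex.
From mathcomp Require Import measurable_realfun ess_sup_inf.
From mathcomp Require Import ring lra.

(** The Wigner distribution W_tau f(x, xi) correlates the values of f at the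
    points u = x + tau y and v = x - (1 - tau) y, and x lies between them at
    distances tau |y| and (1 - tau) |y|. In dimension 2 the sharp bound on
    |W_tau f| is of order 1 / tau near tau = 0, which is not integrable, so the
    Born-Jordan average can only be bounded up to a logarithm. The function
    |w|^-1 detects this: in the plane the square of its L^2 norm diverges
    logarithmically, and its Born-Jordan distribution at the origin diverges
    like the square of that logarithm.

    Its truncation at scale 2^-n is modelled by [spike n], the sum over k < n
    of 2^k times the indicator of the square of half-side 2^-k. The
    contributions of the n scales to the square of its L^2 norm are bounded
    ([integral_sqr_spike_le]), so this square is at most 12 n. On the other
    hand, when |y| <= 2^-k / 2 and tau < 2^(k - j) with k <= j, the points u and
    v lie in the squares of half-side 2^-j and 2^-k, so that each such pair
    (j, k) contributes 2^j 2^k to the integrand on a set of (tau, y) of measure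
    2^(k - j) 4^-k ([spike_pair_ge]). Every pair thus contributes 1 to the
    integral, and there are about n^2 / 2 pairs. The quotient of
    the two is therefore at least of order n.

    Translating the spike by x0 and modulating it by xi0 moves this large value
    to the point (x0, xi0). It persists on a neighbourhood: for x within 2^-n
    of x0 the inclusions above still hold, and for xi close to xi0 the phase
    exp (- 2 i pi (xi - xi0) . y) has real part at least 1 / 2 wherever the
    integrand is supported, since u and v both lie in the square of half-side 1
    around x0 ([Re_born_jordan_packet_ge]). Finally, countably many translates
    of this neighbourhood cover R^4, so one of them meets Omega in a non-null
    set ([exists_cell]), and the essential supremum over Omega sees the large
    value. *)

Set Implicit Arguments.
Unset Strict Implicit.
Unset Printing Implicit Defensive.

Import Order.TTheory GRing.Theory Num.Theory.
Import numFieldNormedType.Exports.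
Import ComplexField.Normc.

Local Open Scope classical_set_scope.
Local Open Scope ring_scope.

Local Notation line R := (measurableTypeR R).
Local Notation plane R := (line R * line R)%type.

(** * Squares and spikes *)

Definition box (R : realType) (c : R * R) (r : R) : set (R * R) :=
  [set w | `|w.1 - c.1| <= r /\ `|w.2 - c.2| <= r].

Lemma boxE (R : realType) (c : R * R) (r : R) :
  box c r = `[c.1 - r, c.1 + r] `*` `[c.2 - r, c.2 + r].
Proof.
apply/seteqP; rewrite /box.
split => [[u v]|[u v]] /=; rewrite !in_itv /= !ler_distl.
  by move=> [/andP[-> ->] /andP[-> ->]].
by move=> [/andP[-> ->] /andP[-> ->]].
Qed.

Lemma measurable_box (R : realType) (c : R * R) (r : R) :
  measurable (box c r : set (plane R)).
Proof. by rewrite boxE; apply: measurableX; exact: measurable_itv. Qed.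

Lemma leb2_box (R : realType) (c : R * R) (r : R) : 0 <= r ->
  @leb2 R (box c r) = (4 * r ^+ 2)%:E.
Proof.
move=> r0; have itvE (a : R) :
    @lebesgue_measure R `[a - r, a + r] = (2 * r)%:E.
  rewrite lebesgue_measure_itv /= lte_fin.
  have [->|rN0] := eqVneq r 0; first by rewrite addr0 subr0 ltxx mulr0.
  have rp : 0 < r by rewrite lt0r rN0.
  by rewrite ifT; [rewrite -EFinD; congr EFin; ring|lra].
rewrite boxE; transitivity ((2 * r)%:E * (2 * r)%:E)%E; last first.
  by rewrite -EFinM; congr EFin; ring.
rewrite -{1}(itvE c.1) -(itvE c.2).
by apply: product_measure1E; exact: measurable_itv.
Qed.

(** A dyadic model of |w - c|^-1, the borderline non-square-integrable
    singularity in the plane, truncated at scale 2^-n. On the k-th dyadic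
    annulus the sum is comparable to its largest term 2^k. *)
Definition spike (R : realType) (n : nat) (c w : R * R) : R :=
  \sum_(k < n) 2 ^+ k * \1_(box c (2 ^- k)) w.

Section spike.
Context (R : realType).
Implicit Types (n : nat) (c w : R * R).

Lemma spike_ge0 n c w : 0 <= spike n c w.
Proof. by apply: sumr_ge0 => k _; rewrite mulr_ge0 ?exprn_ge0. Qed.

Lemma measurable_spike n c : measurable_fun (T := plane R) setT (spike n c).
Proof.
apply: measurable_sum => k; apply: measurable_funM; first exact: measurable_cst.
by apply: measurable_indic; exact: measurable_box.
Qed.

Lemma spike_le n c w : spike n c w <= 2 ^+ n.
Proof.
rewrite /spike; elim: n => [|m IH]; first by rewrite big_ord0 expr0.
rewrite big_ord_recr /= exprS (_ : 2 * 2 ^+ m = 2 ^+ m + 2 ^+ m); last by ring.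
by rewrite lerD// ler_piMr ?exprn_ge0// indicE lern1 leq_b1.
Qed.

Lemma spike_out n c w : ~ box c 1 w -> spike n c w = 0.
Proof.
move=> cw; apply: big1 => k _; rewrite indicE memNset ?mulr0// => -[h1 h2].
have k1 : 2 ^- k <= 1 :> R by rewrite invf_le1 ?exprn_gt0// exprn_ege1// ler1n.
by apply: cw; split; [exact: le_trans h1 k1|exact: le_trans h2 k1].
Qed.

Lemma spike_ge1 n c w : (0 < n)%N -> box c 1 w -> 1 <= spike n c w.
Proof.
case: n => // m _ cw; rewrite /spike big_ord_recl /= expr0 invr1.
rewrite indicE mem_set//.
by rewrite mulr1 lerDl; apply: sumr_ge0 => k _; rewrite mulr_ge0 ?exprn_ge0.
Qed.

Lemma spike_mono m n c w : (m <= n)%N ->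
  spike m c w <= spike n c w.
Proof.
move=> /subnKC <-; elim: (n - m)%N => [|p IH]; first by rewrite addn0.
rewrite addnS (le_trans IH)// /spike big_ord_recr /= lerDl.
by rewrite mulr_ge0 ?exprn_ge0.
Qed.

(** The terms grow geometrically, so the cross terms in the square are
    absorbed by the diagonal: adding 2^m to a sum that is at most 2^m adds at
    most 2 * 2^m * 2^m + 4^m to its square. *)
Lemma sqr_spike_le n c w :
  spike n c w ^+ 2 <= \sum_(k < n) 3 * 4 ^+ k * \1_(box c (2 ^- k)) w.
Proof.
elim: n => [|m IH]; first by rewrite /spike !big_ord0 expr0n.
have := spike_le m c w; have := spike_ge0 m c w; move: IH.
rewrite [spike m.+1 c w]/spike !big_ord_recr /= -/(spike m c w).
rewrite sqrrD -addrA (_ : 4 ^+ m = 2 ^+ m * 2 ^+ m); last first.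
  by rewrite -exprMn; congr (_ ^+ _); ring.
move: (spike m c w) => s IH s0 s_le; rewrite lerD// indicE.
by case: (_ \in _) => /=; rewrite ?mulr1 ?mulr0; nra.
Qed.

Lemma integral_box c (r : R) : 0 <= r ->
  (\int[@leb2 R]_w (\1_(box c r) w)%:E = (4 * r ^+ 2)%:E)%E.
Proof.
move=> r0; rewrite -(leb2_box c r0) -[in RHS](setIT (box c r)).
by apply: integral_indic => //; exact: measurable_box.
Qed.

(** The singularity is critical: every scale has the same mass, the 4^k of the
    integrand compensating the area 4 * 4^-k of the square. *)
Lemma integral_sqr_spike_le n c :
  (\int[@leb2 R]_w (spike n c w ^+ 2)%:E <= (12 * n%:R)%:E)%E.
Proof.
have mbox k : measurable_fun (T := plane R) setT
    (fun w => \1_(box c (2 ^- k)) w : R).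
  by apply: measurable_indic; exact: measurable_box.
have mterm k : measurable_fun (T := plane R) setT (fun w =>
    ((3 * 4 ^+ k)%:E * (\1_(box c (2 ^- k)) w)%:E : \bar R)%E).
  by apply: emeasurable_funM; [exact: measurable_cst|exact/measurable_EFinP].
apply: (@le_trans _ _ (\int[@leb2 R]_w
    \sum_(k < n) (3 * 4 ^+ k)%:E * (\1_(box c (2 ^- k)) w)%:E)%E).
  apply: ge0_le_integral => //.
  - by move=> w _; rewrite lee_fin sqr_ge0.
  - apply/measurable_EFinP; apply: (measurable_funX 2).
    exact: measurable_spike.
  - exact: emeasurable_sum.
  - move=> w _; rewrite [leRHS](_ : _ =
        (\sum_(k < n) 3 * 4 ^+ k * \1_(box c (2 ^- k)) w)%:E).
      by rewrite lee_fin sqr_spike_le.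
    by rewrite -sumEFin; apply: eq_bigr => k _; rewrite EFinM.
rewrite ge0_integral_sum//.
rewrite (eq_bigr (fun=> (12 : R)%:E : \bar R)) => [|k _].
  by rewrite sumEFin lee_fin sumr_const card_ord mulr_natr.
rewrite ge0_integralZl//; last first.
  exact/measurable_EFinP.
rewrite integral_box ?invr_ge0 ?exprn_ge0// -EFinM; congr EFin.
have : (4 : R) ^+ k != 0 by rewrite expf_neq0.
rewrite exprVn -exprM mulnC exprM (_ : 2 ^+ 2 = 4); last by ring.
by move=> h; field.
Qed.
End spike.

(** * Translated and modulated spikes *)

(** The spike centred at [x0], modulated to the frequency [xi0]: the phases
    [cos], [sin] are those of exp (2 i pi xi0 . w). *)
Definition packet (R : realType) (n : nat) (x0 xi0 w : R * R) : R[i] :=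
  Complex (spike n x0 w * cos (2 * pi * dot2 xi0 w))
          (spike n x0 w * sin (2 * pi * dot2 xi0 w)).

Section packet.
Context (R : realType).

Lemma normc_packet (n : nat) (x0 xi0 w : R * R) :
  normc (packet n x0 xi0 w) = spike n x0 w.
Proof.
rewrite /packet /= !exprMn -mulrDr cos2Dsin2 mulr1 sqrtr_sqr ger0_norm//.
exact: spike_ge0.
Qed.

(** Translation and modulation act on Wigner distributions by translating the
    phase space point: the phases of the two factors combine to that of
    exp (2 i pi xi0 . y), because their arguments differ by y. *)
Lemma Re_wigner_integrand (n : nat) (x0 xi0 x xi y : R * R) (tau : R) :
  complex.Re (cis (- (2 * pi * dot2 xi y)) *
    packet n x0 xi0 (x + scale2 tau y) *
    conjc (packet n x0 xi0 (x - scale2 (1 - tau) y))) =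
  cos (2 * pi * dot2 (xi - xi0) y) *
    (spike n x0 (x + scale2 tau y) * spike n x0 (x - scale2 (1 - tau) y)).
Proof.
rewrite /packet /cis /=.
set s := spike _ _ _; set t := spike _ _ _.
set a := 2 * pi * dot2 xi y; set b := 2 * pi * dot2 xi0 (x + _).
set c := 2 * pi * dot2 xi0 (x - _).
have -> : 2 * pi * dot2 (xi - xi0) y = - (- a + b - c).
  by rewrite /a /b /c /dot2 /scale2 /=; ring.
rewrite [in RHS]cosN cosB cosD sinD; ring.
Qed.

Lemma measurable_dot2 (xi0 : R * R) :
  measurable_fun (T := plane R) setT (dot2 xi0).
Proof.
by apply: measurable_funD; apply: measurable_funM => //; exact: measurable_cst.
Qed.

Lemma measurable_cos : measurable_fun (T := line R) setT (@cos R).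
Proof. exact: continuous_measurable_fun (@continuous_cos R). Qed.

Lemma measurable_sin : measurable_fun (T := line R) setT (@sin R).
Proof. exact: continuous_measurable_fun (@continuous_sin R). Qed.

Lemma measurable_Re_packet (n : nat) (x0 xi0 : R * R) :
  measurable_fun (T := plane R) setT
    (fun w => complex.Re (packet n x0 xi0 w)).
Proof.
apply: measurable_funM; first exact: measurable_spike.
apply: (measurableT_comp measurable_cos).
apply: measurable_funM; first exact: measurable_cst.
exact: measurable_dot2.
Qed.

Lemma measurable_Im_packet (n : nat) (x0 xi0 : R * R) :
  measurable_fun (T := plane R) setT
    (fun w => complex.Im (packet n x0 xi0 w)).
Proof.
apply: measurable_funM; first exact: measurable_spike.
apply: (measurableT_comp measurable_sin).
apply: measurable_funM; first exact: measurable_cst.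
exact: measurable_dot2.
Qed.

Lemma L2norm_packet (n : nat) (x0 xi0 : R * R) :
  (L2norm (packet n x0 xi0) `^ 2 =
   \int[@leb2 R]_w (spike n x0 w ^+ 2)%:E)%E.
Proof.
rewrite /L2norm poweR_Lnorm//; apply: eq_integral => w _.
rewrite normc_packet abse_EFin poweR_EFin ger0_norm ?spike_ge0//.
by rewrite powR_mulrn ?spike_ge0.
Qed.

End packet.

Lemma packet_neq0 (R : realType) (n : nat) (x0 xi0 : R * R) :
  (0 < n)%N -> ~ ae_zero (packet n x0 xi0).
Proof.
move=> n0 [A [mA A0 pA]]; have : (@leb2 R (box x0 1) <= @leb2 R A)%E.
  apply: le_measure; rewrite ?inE//; first exact: measurable_box.
  move=> w xw; apply: pA => /= p0; have := spike_ge1 n0 xw.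
  by rewrite -(normc_packet n x0 xi0 w) p0 normc0; lra.
by rewrite A0 leb2_box// lee_fin expr1n; lra.
Qed.

Lemma L2_packet (R : realType) (n : nat) (x0 xi0 : R * R) :
  @L2 R (packet n x0 xi0).
Proof.
split; [exact: measurable_Re_packet|exact: measurable_Im_packet|].
apply: (@lty_poweRy _ _ 2); first by rewrite pnatr_eq0.
by rewrite L2norm_packet (le_lt_trans (integral_sqr_spike_le n x0))// ltry.
Qed.

Lemma L2norm_packet_le (R : realType) (n : nat) (x0 xi0 : R * R) :
  (L2norm (packet n x0 xi0) ^+ 2 <= (12 * n%:R)%:E)%E.
Proof.
have [_ _] := L2_packet n x0 xi0; have := L2norm_packet n x0 xi0.
have := integral_sqr_spike_le n x0; move=> /[swap] <-.
have : (0 <= L2norm (packet n x0 xi0))%E by exact: Lnorm_ge0.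
case: L2norm => // r; rewrite lee_fin => r0 + _.
by rewrite poweR_EFin powR_mulrn.
Qed.

(** * Integrals of dyadic sums, and iterated integrals *)

Lemma integral_sum2_indic d (T : measurableType d) (R : realType)
    (mu : {measure set T -> \bar R}) (D : set T) (n : nat)
    (a : nat -> nat -> R) (A : nat -> nat -> set T) :
  measurable D -> (forall j k, 0 <= a j k) ->
  (forall j k, measurable (A j k)) ->
  (\int[mu]_(t in D) (\sum_(j < n) \sum_(k < j.+1) a j k * \1_(A j k) t)%R%:E =
   \sum_(j < n) \sum_(k < j.+1) (a j k)%:E * mu (A j k `&` D))%E.
Proof.
move=> mD a0 mA.
have m1 j k : measurable_fun D (fun t => (\1_(A j k) t)%:E : \bar R).
  by apply/measurable_EFinP; exact: measurable_indic.
have mt j k : measurable_fun D (fun t => ((a j k)%:E * (\1_(A j k) t)%:E)%E).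
  by apply: emeasurable_funM; [exact: measurable_cst|exact: m1].
have t0 j k t : (0 <= (a j k)%:E * (\1_(A j k) t)%:E :> \bar R)%E.
  by rewrite -EFinM lee_fin mulr_ge0.
transitivity (\int[mu]_(t in D)
    (\sum_(j < n) \sum_(k < j.+1) (a j k)%:E * (\1_(A j k) t)%:E))%E.
  apply: eq_integral => t _; rewrite -sumEFin; apply: eq_bigr => j _.
  by rewrite -sumEFin; apply: eq_bigr => k _; rewrite EFinM.
rewrite ge0_integral_sum//; last 2 first.
- by move=> j; exact: emeasurable_sum.
- by move=> j t _; apply: sume_ge0.
apply: eq_bigr => j _; rewrite ge0_integral_sum//; apply: eq_bigr => k _.
by rewrite ge0_integralZl ?integral_indic// ?lee_fin// => t _; rewrite lee_fin.
Qed.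

(** A real-valued integral is 0 when the extended one is infinite. The bound [M]
    and the finiteness of [D] rule this out for both integrals, so that they
    may be compared through the extended ones. *)
Lemma iterated_Rintegral_ge d1 d2 (T1 : measurableType d1)
    (T2 : measurableType d2) (R : realType) (m1 : {measure set T1 -> \bar R})
    (m2 : {sigma_finite_measure set T2 -> \bar R}) (D : set T1)
    (h : T1 * T2 -> R) (l : T1 -> R) (M : R) :
  measurable D -> (m1 D < +oo)%E ->
  measurable_fun setT h -> (forall p, 0 <= h p) ->
  measurable_fun D l -> (forall t, D t -> 0 <= l t) ->
  (forall t, D t -> ((l t)%:E <= \int[m2]_y (h (t, y))%:E <= M%:E)%E) ->
  (\int[m1]_(t in D) (l t)%:E <=
   (\int[m1]_(t in D) \int[m2]_y h (t, y))%R%:E)%E.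
Proof.
move=> mD m1D mh h0 ml l0 lhM.
pose F t := (\int[m2]_y (h (t, y))%:E)%E.
have F0 t : (0 <= F t)%E by apply: integral_ge0 => y _; rewrite lee_fin.
have mF : measurable_fun setT F.
  by apply: (measurable_fun_fubini_tonelli_F (EFin \o h)) => //;
    exact/measurable_EFinP.
have mFD : measurable_fun D F by exact: measurable_funTS.
have Ffin t : D t -> F t \is a fin_num.
  move=> /lhM /andP[_ FM]; rewrite ge0_fin_numE//.
  by rewrite (le_lt_trans FM)// ltry.
have -> : (\int[m1]_(t in D) \int[m2]_y h (t, y))%R =
    fine (\int[m1]_(t in D) F t)%E.
  by congr fine; apply: eq_integral => t /set_mem Dt; rewrite fineK// Ffin.
rewrite fineK.
  apply: ge0_le_integral => //; first exact/measurable_EFinP.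
  by move=> t /lhM /andP[].
rewrite ge0_fin_numE; last exact: integral_ge0.
apply: (@le_lt_trans _ _ (\int[m1]_(t in D) M%:E)%E).
  by apply: ge0_le_integral => // t /lhM /andP[].
by rewrite integral_cst// ltey_eq fin_numM// ge0_fin_numE.
Qed.

(** * The correlation of two values of a spike *)

Lemma cos_ge_half (R : realType) : exists2 e : R, 0 < e &
  forall v y : R * R, box 0 e v -> box 0 2 y -> 2^-1 <= cos (2 * pi * dot2 v y).
Proof.
have : \forall t \near (0 : R), 2^-1 < cos t.
  have c0 : cos t @[t --> (0 : R)] --> (1 : R).
    by rewrite -[X in _ --> X]cos0; exact: continuous_cos.
  by apply: cvgr_gt c0 _ _; lra.
move=> /nbhs_ballP[/= d d0 dcos].
have pi0 := pi_gt0 R.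
exists (d / (16 * pi)); first by rewrite divr_gt0// mulr_gt0.
move=> v y [] /=; rewrite !subr0 => v1 v2 [] /=; rewrite !subr0 => y1 y2.
apply/ltW/dcos; rewrite /ball /= sub0r normrN /dot2 normrM.
rewrite (gtr0_norm (_ : 0 < 2 * pi)) ?mulr_gt0//.
have h1 : `|v.1 * y.1| <= d / (16 * pi) * 2 by rewrite normrM ler_pM.
have h2 : `|v.2 * y.2| <= d / (16 * pi) * 2 by rewrite normrM ler_pM.
apply: (@le_lt_trans _ _ (2 * pi * (d / (16 * pi) * 2 + d / (16 * pi) * 2))).
  by rewrite ler_pM2l ?mulr_gt0// (le_trans (ler_normD _ _))// lerD.
have key (p : R) : 0 < p ->
    2 * p * (d / (16 * p) * 2 + d / (16 * p) * 2) = d / 2.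
  by move=> p0; field; rewrite gt_eqF.
rewrite key//.
by lra.
Qed.

(** The two arguments differ by [y], so they cannot both lie in the square of
    half-side 1 when [y] is outside that of half-side 2. *)
Lemma spike_pair_out (R : realType) (n : nat) (c x y : R * R) (tau : R) :
  ~ box 0 2 y ->
  spike n c (x + scale2 tau y) * spike n c (x - scale2 (1 - tau) y) = 0.
Proof.
move=> yN; have [b1|/spike_out ->] := pselect (box c 1 (x + scale2 tau y));
  last by rewrite mul0r.
have [b2|/spike_out ->] := pselect (box c 1 (x - scale2 (1 - tau) y));
  last by rewrite mulr0.
exfalso; apply: yN; move: b1 b2; rewrite /box /scale2 /= !subr0 !ler_norml.
by move=> [/andP[? ?] /andP[? ?]] [/andP[? ?] /andP[? ?]]; split; lra.
Qed.

(** The product of the two sums is bounded below by its terms with k <= j, for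
    which the first argument is in the smaller square. The displacement
    [tau * y] of the first argument is then at most 2^-j / 2, that of the second
    at most 2^-k / 2, and the offset 2^-n of [x] fits in the other half of
    both squares since k <= j < n. *)
Lemma spike_pair_ge (R : realType) (n : nat) (c x y : R * R) (tau : R) :
  box c (2 ^- n) x -> 0 < tau < 1 ->
  \sum_(j < n) \sum_(k < j.+1) 2 ^+ j * 2 ^+ k *
     (\1_(`]0, 2 ^+ k / 2 ^+ j[) tau * \1_(box 0 (2 ^- k / 2)) y) <=
  spike n c (x + scale2 tau y) * spike n c (x - scale2 (1 - tau) y).
Proof.
move=> [x1 x2] /andP[t0 t1]; rewrite {1}/spike mulr_suml; apply: ler_sum => j _.
apply: (@le_trans _ _ (2 ^+ j * \1_(box c (2 ^- j)) (x + scale2 tau y) *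
    spike j.+1 c (x - scale2 (1 - tau) y))); last first.
  by rewrite ler_wpM2l ?mulr_ge0 ?exprn_ge0// spike_mono.
rewrite /spike mulr_sumr; apply: ler_sum => k _.
rewrite [leRHS]mulrACA ler_wpM2l ?mulr_ge0 ?exprn_ge0//.
rewrite !indicE; case: (boolP (tau \in _)) => [|_]; last first.
  by rewrite mul0r mulr_ge0.
rewrite inE /= in_itv /= => /andP[_ tjk].
case: (boolP (y \in _)) => [|_]; last by rewrite mulr0 mulr_ge0.
rewrite inE => -[] /=; rewrite !subr0 => y1 y2.
have nj : 2 ^- n <= 2 ^- j / 2 :> R.
  rewrite -invfM -exprSr lef_pV2 ?posrE ?exprn_gt0//.
  by rewrite ler_weXn2l// ler1n.
have jk : 2 ^- j <= 2 ^- k :> R.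
  by rewrite lef_pV2 ?posrE ?exprn_gt0// ler_weXn2l ?ler1n -1?ltnS.
have tjk2 : tau * (2 ^- k / 2) <= 2 ^- j / 2.
  rewrite mulrA ler_pM2r ?invr_gt0// -ler_pdivlMr ?invr_gt0 ?exprn_gt0//.
  by rewrite invrK mulrC ltW.
have ty (u : R) : `|u| <= 2 ^- k / 2 -> `|tau * u| <= 2 ^- j / 2.
  by move=> uk; rewrite normrM gtr0_norm// (le_trans _ tjk2)// ler_pM2l.
have sy (u : R) : `|u| <= 2 ^- k / 2 -> `|(1 - tau) * u| <= 2 ^- k / 2.
  move=> uk; rewrite normrM gtr0_norm ?subr_gt0// -[leRHS]mul1r ler_pM//; lra.
have := ty _ y1; have := ty _ y2; have := sy _ y1; have := sy _ y2.
move: x1 x2; rewrite !ler_norml.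
move=> /andP[? ?] /andP[? ?] /andP[? ?] /andP[? ?] /andP[? ?] /andP[? ?].
by rewrite !mem_set ?mulr1// /box /scale2 /= !ler_norml; split; lra.
Qed.

Lemma measurable_spike_pair d (T : measurableType d) (R : realType) (n : nat)
    (c : R * R) (u v : T -> R) :
  measurable_fun setT u -> measurable_fun setT v ->
  measurable_fun setT (fun t => spike n c (u t, v t)).
Proof.
move=> mu mv; apply: (measurableT_comp (measurable_spike n c)).
by apply: (@measurable_fun_pair _ _ _ _ (line R) (line R)).
Qed.

(** * Lower bound for the Born-Jordan distribution *)

Lemma sum_triangle_ge (R : realType) (n : nat) :
  n%:R ^+ 2 / 4 <= \sum_(j < n) \sum_(k < j.+1) 2^-1 :> R.
Proof.
elim: n => [|n IH]; first by rewrite big_ord0 expr0n mul0r.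
rewrite big_ord_recr /= sumr_const card_ord.
apply: (@le_trans _ _ (n%:R ^+ 2 / 4 + 2^-1 *+ n.+1)); last by rewrite lerD2r.
rewrite -[2^-1 *+ n.+1]mulr_natr -natr1; move: (ler0n R n); nra.
Qed.

Section born_jordan_packet.
Context (R : realType) (n : nat) (e : R) (x0 xi0 x xi : R * R).
Context (cos_e : forall v y : R * R, box 0 e v -> box 0 2 y ->
  2^-1 <= cos (2 * pi * dot2 v y)).
Context (x_near : box x0 (2 ^- n) x) (xi_near : box xi0 e xi).

(** The real part of the integrand of W_tau (packet n x0 xi0) (x, xi), as a
    function of (tau, y). *)
Let h (p : line R * plane R) : R :=
  cos (2 * pi * dot2 (xi - xi0) p.2) *
    (spike n x0 (x + scale2 p.1 p.2) * spike n x0 (x - scale2 (1 - p.1) p.2)).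

(** A lower bound for the real part of W_tau at tau = t, obtained by integrating
    over y the lower bound of [spike_pair_ge]: the coefficient is 1/2 (the
    cosine) times 2^j 2^k times the area 4^-k of the square of half-side
    2^-k / 2. *)
Let l (t : line R) : R :=
  \sum_(j < n) \sum_(k < j.+1)
    2 ^+ j / 2 ^+ k / 2 * \1_(`]0, 2 ^+ k / 2 ^+ j[) t.

Let measurable_h : measurable_fun setT h.
Proof.
apply: measurable_funM.
  apply: (measurableT_comp (@measurable_cos R)).
  apply: measurable_funM; first exact: measurable_cst.
  exact: (measurableT_comp (measurable_dot2 (xi - xi0))).
have mp : measurable_fun setT (fun p : line R * plane R => p.1 : R).
  exact: measurable_fst.
have mp1 : measurable_fun setT (fun p : line R * plane R => p.2.1 : R).
  exact: (measurableT_comp measurable_fst).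
have mp2 : measurable_fun setT (fun p : line R * plane R => p.2.2 : R).
  exact: (measurableT_comp measurable_snd).
apply: measurable_funM; apply: measurable_spike_pair => /=.
- by apply: measurable_funD => //; apply: measurable_funM.
- by apply: measurable_funD => //; apply: measurable_funM.
- apply: measurable_funB => //; apply: measurable_funM => //.
  exact: measurable_funB.
- apply: measurable_funB => //; apply: measurable_funM => //.
  exact: measurable_funB.
Qed.

Let h_ge t y : 2^-1 * (spike n x0 (x + scale2 t y) *
  spike n x0 (x - scale2 (1 - t) y)) <= h (t, y).
Proof.
rewrite /h /=; have [yb|yN] := pselect (box 0 2 y); last first.
  by rewrite spike_pair_out// !mulr0.
rewrite ler_wpM2r ?mulr_ge0 ?spike_ge0// cos_e//.
by move: xi_near; rewrite /box /= !subr0.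
Qed.

Let h_ge0 p : 0 <= h p.
Proof.
case: p => t y; apply: le_trans (h_ge t y).
by rewrite !mulr_ge0 ?spike_ge0.
Qed.

Let h_le t y : h (t, y) <= 4 ^+ n * \1_(box 0 2) y.
Proof.
rewrite /h /=; have [yb|yN] := pselect (box 0 2 y); last first.
  by rewrite spike_pair_out// mulr0 mulr_ge0 ?exprn_ge0.
rewrite indicE mem_set// mulr1 (_ : 4 ^+ n = 1 * (2 ^+ n * 2 ^+ n)); last first.
  by rewrite -exprMn mul1r; congr (_ ^+ _); ring.
apply: (@le_trans _ _ (1 * (spike n x0 (x + scale2 t y) *
  spike n x0 (x - scale2 (1 - t) y)))).
  by rewrite ler_wpM2r ?cos_le1// mulr_ge0 ?spike_ge0.
by rewrite !mul1r ler_pM ?spike_ge0 ?spike_le.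
Qed.

Let int_h_le t : (\int[@leb2 R]_y (h (t, y))%:E <= (16 * 4 ^+ n)%:E)%E.
Proof.
have m1 : measurable_fun (T := plane R) setT
    (fun y => (\1_(box 0 2) y)%:E : \bar R).
  by apply/measurable_EFinP; apply: measurable_indic; exact: measurable_box.
apply: (@le_trans _ _ (\int[@leb2 R]_y ((4 ^+ n)%:E * (\1_(box 0 2) y)%:E))%E).
  apply: ge0_le_integral => //.
  - by move=> y _; rewrite lee_fin.
  - by apply/measurable_EFinP; exact: measurable_fun_pair2 measurable_h.
  - by apply: emeasurable_funM => //.
  - by move=> y _; rewrite -EFinM lee_fin.
rewrite ge0_integralZl// ?lee_fin ?exprn_ge0//.
rewrite integral_box//.
by rewrite -EFinM lee_fin; lra.
Qed.

Let int_h_ge t : 0 < t < 1 -> ((l t)%:E <= \int[@leb2 R]_y (h (t, y))%:E)%E.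
Proof.
move=> t01.
pose a j k := 2^-1 * (2 ^+ j * 2 ^+ k * \1_(`]0, (2 ^+ k / 2 ^+ j : R)[) t) : R.
pose A (j k : nat) : set (plane R) := box 0 (2 ^- k / 2).
have a0 j k : 0 <= a j k by rewrite /a !mulr_ge0 ?exprn_ge0 ?invr_ge0.
have mA j k : measurable (A j k) by exact: measurable_box.
have -> : ((l t)%:E = \sum_(j < n) \sum_(k < j.+1) (a j k)%:E *
    @leb2 R (A j k `&` setT))%E.
  rewrite /l -sumEFin; apply: eq_bigr => j _.
  rewrite -sumEFin; apply: eq_bigr => k _.
  rewrite setIT leb2_box ?divr_ge0 ?invr_ge0 ?exprn_ge0// -EFinM; congr EFin.
  rewrite /a; move: (\1_ _ _ : R) => i.
  have : (2 : R) ^+ k != 0 by rewrite expf_neq0.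
  have : (2 : R) ^+ j != 0 by rewrite expf_neq0.
  by move: (2 ^+ j) (2 ^+ k) => u v u0 v0; field.
rewrite -integral_sum2_indic//; apply: ge0_le_integral => //.
- move=> y _; rewrite lee_fin; apply: sumr_ge0 => j _; apply: sumr_ge0 => k _.
  by rewrite mulr_ge0.
- apply/measurable_EFinP; apply: measurable_sum => j.
  apply: measurable_sum => k.
  apply: measurable_funM; first exact: measurable_cst.
  exact: measurable_indic.
- by apply/measurable_EFinP; exact: measurable_fun_pair2 measurable_h.
move=> y _; rewrite lee_fin; apply: le_trans (h_ge t y).
apply: (@le_trans _ _ (2^-1 * (\sum_(j < n) \sum_(k < j.+1) 2 ^+ j * 2 ^+ k *
     (\1_(`]0, 2 ^+ k / 2 ^+ j[) t * \1_(box 0 (2 ^- k / 2)) y)))); last first.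
  by rewrite ler_wpM2l ?invr_ge0// spike_pair_ge.
rewrite mulr_sumr ler_sum// => j _; rewrite mulr_sumr ler_sum// => k _.
by rewrite /a !mulrA.
Qed.

(** Each of the n (n + 1) / 2 pairs (j, k) contributes 1/2: the height
    2^j / 2^k of the step compensates its width 2^k / 2^j. *)
Let int_l : ((n%:R ^+ 2 / 4)%:E <=
  \int[@lebesgue_measure R]_(t in `]0%R, 1%R[) (l t)%:E)%E.
Proof.
rewrite (integral_sum2_indic (@lebesgue_measure R) n
  (a := fun j k => 2 ^+ j / 2 ^+ k / 2)
  (A := fun j k => `]0, (2 ^+ k / 2 ^+ j)[%classic)); last 3 first.
- exact: measurable_itv.
- by move=> j k; rewrite !divr_ge0 ?exprn_ge0.
- by move=> j k; exact: measurable_itv.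
apply: (@le_trans _ _ (\sum_(j < n) \sum_(k < j.+1) (2^-1 : R)%:E)%E).
  rewrite (eq_bigr (fun j : 'I_n => (\sum_(k < j.+1) 2^-1 : R)%:E)); last first.
    by move=> j _; rewrite sumEFin.
  by rewrite sumEFin lee_fin sum_triangle_ge.
apply: lee_sum => j _; apply: lee_sum => k _.
have jk : 2 ^+ k <= 2 ^+ j :> R by rewrite ler_weXn2l ?ler1n -1?ltnS.
have j0 : 0 < 2 ^+ j :> R by rewrite exprn_gt0.
have k0 : 0 < 2 ^+ k :> R by rewrite exprn_gt0.
have kj1 : 2 ^+ k / 2 ^+ j <= 1 :> R by rewrite ler_pdivrMr// mul1r.
rewrite setIidl; last first.
  by move=> t /=; rewrite !in_itv /= => /andP[-> /lt_le_trans]; exact.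
have mE : @lebesgue_measure R `]0, (2 ^+ k / 2 ^+ j)[ = (2 ^+ k / 2 ^+ j)%:E.
  by rewrite lebesgue_measure_itv /= lte_fin divr_gt0// -EFinD subr0.
rewrite [leRHS](_ : _ = (2 ^+ j / 2 ^+ k / 2)%:E * (2 ^+ k / 2 ^+ j)%:E)%E;
  last by rewrite -mE.
rewrite -EFinM lee_fin; move: k0 j0; move: (2 ^+ k) (2 ^+ j) => u v u0 v0.
by rewrite [leRHS](_ : _ = 2^-1)//; field; rewrite !gt_eqF.
Qed.

Lemma Re_born_jordan_packet_ge :
  n%:R ^+ 2 / 4 <= complex.Re (born_jordan (packet n x0 xi0) (x, xi)).
Proof.
have -> : complex.Re (born_jordan (packet n x0 xi0) (x, xi)) =
    \int[@lebesgue_measure R]_(t in `]0, 1[) \int[@leb2 R]_y h (t, y).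
  rewrite /born_jordan /=; apply: eq_Rintegral => t _.
  rewrite /wigner_tau /=; apply: eq_Rintegral => y _.
  exact: Re_wigner_integrand.
rewrite -lee_fin (le_trans int_l)//.
apply: (@iterated_Rintegral_ge _ _ _ _ _ _ _ _ _ _ (16 * 4 ^+ n)) => //.
- suff : (@lebesgue_measure R `]0%R, 1%R[ < +oo)%E by [].
  by rewrite lebesgue_measure_itv /= lte_fin ltr01 -EFinD ltry.
- apply: measurable_funTS; apply: measurable_sum => j.
  apply: measurable_sum => k.
  apply: measurable_funM; first exact: measurable_cst.
  by apply: measurable_indic; exact: measurable_itv.
- move=> t _; apply: sumr_ge0 => j _; apply: sumr_ge0 => k _.
  by rewrite mulr_ge0 ?divr_ge0 ?exprn_ge0.
- by move=> t; rewrite /= in_itv /= => t01; rewrite int_h_ge// int_h_le.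
Qed.

End born_jordan_packet.

(** * Essential suprema and non-null cells *)

Section cells.
Context (R : realType).
Local Open Scope ereal_scope.

Lemma not_negligible4 (Omega : set ((R * R) * (R * R))) :
  0 < lebesgue4 Omega -> ~ (@leb4 R).-negligible Omega.
Proof.
move=> O0 [A [mA A0 OA]]; move: O0; rewrite ltNge => /negP; apply.
rewrite -[leRHS]A0 -[leRHS]measurable_mu_extE//.
exact: le_mu_ext.
Qed.

(** The squares centred at the points of the lattice rZ^4 cover R^4, and there
    are countably many of them. *)
Lemma exists_cell (Omega : set ((R * R) * (R * R))) (r : R) :
  (0 < r)%R -> ~ (@leb4 R).-negligible Omega ->
  exists c : (R * R) * (R * R),
    ~ (@leb4 R).-negligible (Omega `&` (box c.1 r `*` box c.2 r)).
Proof.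
move=> r0; apply: contra_notP => /forallNP cells.
pose grid (p : (int * int) * (int * int)) : (R * R) * (R * R) :=
  ((p.1.1%:~R * r, p.1.2%:~R * r), (p.2.1%:~R * r, p.2.2%:~R * r))%R.
pose F k := if @unpickle ((int * int) * (int * int))%type k is Some p
  then Omega `&` (box (grid p).1 r `*` box (grid p).2 r) else set0.
have negF : (@leb4 R).-negligible (\bigcup_k F k).
  apply: (@negligible_bigcup _ _ _ (@leb4 R)) => k.
  rewrite /F; case: unpickle => [p|].
    exact: contrapT (cells (grid p)).
  exact: negligible_set0.
apply: (@negligibleS _ _ _ (@leb4 R)) negF.
have near (u : R) : (`|u - (Num.floor (u / r))%:~R * r| <= r)%R.
  have /andP[f1 f2] := floor_itv (u / r).
  rewrite ler_distl; move: f1 f2; rewrite intrD.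
  rewrite ler_pdivlMr// ltr_pdivrMr// => f1 f2.
  by apply/andP; split; lra.
move=> [[u1 u2] [v1 v2]] Oz.
pose p := ((Num.floor (u1 / r), Num.floor (u2 / r)),
  (Num.floor (v1 / r), Num.floor (v2 / r))).
exists (pickle p); first exact: I.
rewrite /F pickleK; split; first exact: Oz.
by split; split; exact: near.
Qed.

Lemma Linfty_norm_ge (Omega cell : set ((R * R) * (R * R)))
    (g : (R * R) * (R * R) -> R[i]) (a : R) :
  ~ (@leb4 R).-negligible (Omega `&` cell) ->
  (forall z, cell z -> (a <= normc (g z))%R) ->
  a%:E <= Linfty_norm Omega g.
Proof.
move=> notneg ag; rewrite /Linfty_norm unlock /=.
case: ifPn => [_|]; last first.
  (* If the whole space were null, every set would be negligible. *)
  rewrite -leNgt => le0; exfalso; apply: notneg; exists setT; split => //.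
  by apply/eqP; rewrite eq_le le0 measure_ge0.
rewrite leNgt; apply/negP => lta; apply: notneg.
have := ess_sup_ge (@leb4 R) (abse \o (fun z => (normc (g z))%:E) \_ Omega).
apply: negligibleS => z [Oz cz] /=.
rewrite patchE mem_set// => /le_lt_trans /(_ lta); apply/negP.
by rewrite -leNgt lee_fin (le_trans (ag z cz))// ler_norm.
Qed.

End cells.

Lemma Re_le_normc (R : realType) (z : R[i]) : complex.Re z <= normc z.
Proof.
case: z => a b /=; rewrite (le_trans (ler_norm _))// -sqrtr_sqr.
rewrite ler_sqrt ?addr_ge0 ?sqr_ge0//.
by rewrite lerDl sqr_ge0.
Qed.

(** * Unboundedness *)

Local Open Scope ereal_scope.

Theorem theorem1p5 (R : realType) (Omega : set ((R * R) * (R * R)))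
    (mOmega : lebesgue_measurable4 Omega) (Omega_gt0 : 0 < lebesgue4 Omega) :
  ereal_sup [set Linfty_norm Omega (born_jordan f) / L2norm f ^+ 2
            | f in [set f | @L2 R f /\ ~ ae_zero f]] = +oo.
Proof.
apply/eqyP => A A0.
have [e e0 cos_e] := cos_ge_half R.
(* The quotient will be at least (n^2 / 4) / (12 n) = n / 48. *)
pose n := (Num.truncn (48 * A)).+1.
have An : (A <= n%:R / 48)%R.
  have : (48 * A < n%:R)%R by rewrite truncnS_gt.
  lra.
have n0 : (0 < n%:R :> R)%R by rewrite ltr0n.
(* Any point of R^4 is the centre of a cell of half-side [r] on which a suitable
   packet has a large Born-Jordan distribution. *)
pose r : R := Num.min e (2 ^- n).
have r0 : (0 < r)%R by rewrite lt_min e0 invr_gt0 exprn_gt0.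
have [c notneg] := exists_cell r0 (not_negligible4 Omega_gt0).
have lower : (n%:R ^+ 2 / 4)%:E <=
    Linfty_norm Omega (born_jordan (packet n c.1 c.2)).
  apply: (Linfty_norm_ge notneg) => -[x xi] [[x1 x2] [xi1 xi2]].
  apply: le_trans (Re_le_normc _).
  apply: (Re_born_jordan_packet_ge cos_e).
    by split; [apply: le_trans x1 _|apply: le_trans x2 _];
      rewrite ge_min lexx orbT.
  by split; [apply: le_trans xi1 _|apply: le_trans xi2 _];
    rewrite ge_min lexx.
apply: (@le_trans _ _ (Linfty_norm Omega (born_jordan (packet n c.1 c.2)) /
    L2norm (packet n c.1 c.2) ^+ 2)); last first.
  apply: ereal_sup_ubound; exists (packet n c.1 c.2) => //.
  by split; [exact: L2_packet|exact: packet_neq0].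
have L20 : 0 <= L2norm (packet n c.1 c.2) ^+ 2.
  by rewrite sqre_ge0.
apply: (@le_trans _ _ ((n%:R ^+ 2 / 4)%:E * (12 * n%:R)%:E^-1)).
  rewrite inver gt_eqF ?mulr_gt0// -EFinM lee_fin (le_trans An)//.
  by rewrite [leRHS](_ : _ = n%:R / 48)%R//; field; rewrite gt_eqF.
apply: lee_pmul => //.
- by rewrite inve_ge0 lee_fin mulr_ge0.
- by rewrite lee_pV2 ?inE ?lee_fin ?mulr_ge0// L2norm_packet_le.
Qed.
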